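(* For positive integers $N$, as $N\to\infty$, $$\log\left(\prod_{n=1}^Nn^{(-1)^n}\right)=\log\sqrt{\frac\pi2}+\frac{(-1)^N}{2}\log N+\frac{(-1)^N}{4N}+O(N^{-2}).$$ *)

(* Defs.v *)
From mathcomp Require Export all_boot all_order all_algebra.
From mathcomp Require Export all_classical all_reals all_analysis.
Export numFieldNormedType.Exports.

(* Main.v *)
Require Import Defs.
From mathcomp Require Import ring lra.
Import Order.TTheory GRing.Theory Num.Theory.
Local Open Scope classical_set_scope.
Local Open Scope ring_scope.

(** Write [P N] for the product and [W m] for [P (2 m)], the Wallis product
    [2/1 * 4/3 * ... * 2m/(2m-1)].  The whole expansion follows from the
    two-sided estimate
      [pi (m + 1/4) <= (W m)^2 <= pi (m + 1/4 + 1/(32 m))]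
    ([wallis_sharp_lower], [wallis_sharp_upper]).  Indeed [pi (m + 1/4)] is
    [pi/2 * (N + 1/2)] at [N = 2 m], so taking logarithms gives
      [2 ln (P N) = ln (pi/2) + ln (N + 1/2) + O(1/N^2)] for even [N].
    For odd [N], [P N = P (N - 1) / N] turns this into
      [2 ln (P N) = ln (pi/2) + ln (N - 1/2) - 2 ln N + O(1/N^2)],
    and both cases read
      [2 ln (P N) = ln (pi/2) + s ln N + ln (1 + s/(2N)) + O(1/N^2)]
    with [s = (-1)^N] ([ln_altprod_near]).  The expansion
    [ln (1 + x) = x + O(x^2)] concludes.

    The estimate itself is proved in two stages.  The Wallis integrals
    [I n], the integrals of [sin^n] from [0] to [pi/2], satisfy
    [I (n+2) = (n+1)/(n+2) I n], whence [I (2m) = (pi/2) / W m] and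
    [I (2m+1) = W m / (2m+1)]; since they decrease with [n],
    [pi m <= (W m)^2 <= pi (m + 1/2)].  In particular [(W m)^2 / m] tends to
    [pi].  Next, [(W m)^2 / (m + 1/4)] is nonincreasing and
    [(W m)^2 / (m + 1/4 + 1/(32 m))] is nondecreasing, by a polynomial
    inequality on the ratio of consecutive terms; both tend to [pi], so the
    first stays above [pi] and the second below.

    No integral is formed: [I n] is the value at [pi/2] of an explicit
    antiderivative of [sin^n] that vanishes at [0]. *)

(** * Wallis integrals *)

(** Integration by parts of [sin^(k+2) = sin^(k+1) * sin], solved for the
    integral of [sin^(k+2)], gives the recursive clause. *)
Fixpoint sinX_primitive {R : realType} (n : nat) (x : R) : R :=
  match n with
  | 0 => x
  | 1 => 1 - cos x
  | k.+2 => (k.+1%:R * sinX_primitive k x - sin x ^+ k.+1 * cos x) / k.+2%:R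
  end.

Lemma nat_ind2 (P : nat -> Prop) :
  P 0%N -> P 1%N -> (forall n, P n -> P n.+2) -> forall n, P n.
Proof.
move=> P0 P1 P2 n; suff: P n /\ P n.+1 by case.
by elim: n => // n [Pn Pn1]; split=> //; exact: P2.
Qed.

Lemma is_derive_sinX_primitive (R : realType) (n : nat) (x : R) :
  is_derive x 1 (@sinX_primitive R n) (sin x ^+ n).
Proof.
elim/nat_ind2: n => [||k IH]; rewrite /=.
- by apply: is_derive_eq; rewrite expr0.
- apply: is_derive_eq; rewrite expr1; ring.
- have Dsc := is_deriveM (is_deriveX k.+1 (is_derive_sin x)) (is_derive_cos x).
  have := is_deriveZ k.+2%:R^-1 (is_deriveB (is_deriveZ k.+1%:R IH) Dsc).
  set g := (X in is_derive x 1 X _); set f := (X in _ -> is_derive x 1 X _).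
  have -> : g = f by apply/funext => y; rewrite /f /g exprfctE [RHS]mulrC.
  move=> /is_derive_eq; apply.
  change (k.+2%:R^-1 * (k.+1%:R * sin x ^+ k - ((sin ^+ k.+1) x * - sin x +
    cos x * ((k.+1%:R * sin x ^+ k) * cos x))) = sin x ^+ k.+2).
  have k2 : k.+2%:R != 0 :> R by rewrite pnatr_eq0.
  apply: (mulfI k2); rewrite mulVKf// exprfctE -(natr1 k.+1).
  rewrite [cos x * _](_ : _ = k.+1%:R * sin x ^+ k * cos x ^+ 2); last by ring.
  have -> : cos x ^+ 2 = 1 - sin x ^+ 2 by rewrite -(cos2Dsin2 x) addrK.
  rewrite !exprS; ring.
Qed.

Lemma sinX_primitive0 (R : realType) (n : nat) : @sinX_primitive R n 0 = 0.
Proof.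
elim/nat_ind2: n => [||k IH] //=; first by rewrite cos0 subrr.
by rewrite IH sin0 exprS !mul0r mulr0 subrr mul0r.
Qed.

Lemma sinX_primitive_pihalfSS (R : realType) (n : nat) :
  sinX_primitive n.+2 (pi / 2 : R) =
  n.+1%:R / n.+2%:R * sinX_primitive n (pi / 2).
Proof. by rewrite /= cos_pihalf mulr0 subr0 mulrAC. Qed.

(** Between [0] and [pi/2] the difference of the two antiderivatives has
    derivative [sin^n (1 - sin) >= 0], and it vanishes at [0]. *)
Lemma sinX_primitive_pihalf_nincr (R : realType) (n : nat) :
  sinX_primitive n.+1 (pi / 2 : R) <= sinX_primitive n (pi / 2).
Proof.
pose f : R -> R := @sinX_primitive R n - @sinX_primitive R n.+1.
have df (x : R) : is_derive x 1 f (sin x ^+ n - sin x ^+ n.+1).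
  have := is_derive_sinX_primitive R n x.
  have := is_derive_sinX_primitive R n.+1 x.
  move=> *; exact: is_deriveB.
have dfx (x : R) : derivable f x 1 by have [] := df x.
have p0 : 0 <= pi / 2 :> R by rewrite divr_ge0// pi_ge0.
rewrite -subr_ge0.
have <- : f 0 = 0.
  change (sinX_primitive n (0 : R) - sinX_primitive n.+1 (0 : R) = 0).
  by rewrite !sinX_primitive0 subrr.
change (f 0 <= f (pi / 2)).
apply: (@ger0_derive1_le_cc R f 0 (pi / 2)) => //.
- move=> x; rewrite in_itv/= => /andP[x0 xp].
  rewrite derive1E (@derive_val _ _ _ _ _ _ _ (df x)) exprS -[X in X - _]mul1r -mulrBl.
  rewrite mulr_ge0 ?subr_ge0 ?sin_le1// exprn_ge0// ltW// sin_gt0_pihalf//.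
  by rewrite x0.
- apply: continuous_subspaceT => x.
  exact/differentiable_continuous/derivable1_diffP.
- by rewrite in_itv/= lexx.
- by rewrite in_itv/= p0 lexx.
Qed.

(** * The alternating product and the classical Wallis bounds *)

Definition altprod (R : realType) (N : nat) : R :=
  \prod_(1 <= n < N.+1) (n%:R : R) ^ ((-1 : int) ^+ n).

Lemma altprod0 (R : realType) : altprod R 0 = 1.
Proof. by rewrite /altprod big_geq. Qed.

Lemma altprod_odd (R : realType) (m : nat) :
  altprod R m.*2.+1 = altprod R m.*2 / m.*2.+1%:R.
Proof.
by rewrite /altprod big_nat_recr//= -signr_odd /= odd_double expr1 exprN1.
Qed.

Lemma altprod_evenS (R : realType) (m : nat) :
  altprod R m.+1.*2 = altprod R m.*2 * (m.*2.+2%:R / m.*2.+1%:R).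
Proof.
transitivity (altprod R m.*2.+1 * m.*2.+2%:R); last first.
  by rewrite altprod_odd -mulrA [_^-1 * _]mulrC.
by rewrite {1}/altprod doubleS big_nat_recr//= -signr_odd /= odd_double.
Qed.

Lemma altprod_gt0 (R : realType) (N : nat) : 0 < altprod R N.
Proof.
rewrite /altprod big_nat_cond; apply: prodr_gt0 => n /andP[/andP[n0 _] _].
by rewrite exprz_gt0// ltr0n.
Qed.

Lemma sinX_primitive_pihalf_odd (R : realType) (m : nat) :
  sinX_primitive m.*2.+1 (pi / 2 : R) = altprod R m.*2.+1.
Proof.
elim: m => [|m IH].
  by rewrite (altprod_odd R 0) altprod0 divr1 /= cos_pihalf subr0.
rewrite altprod_odd altprod_evenS.
rewrite doubleS sinX_primitive_pihalfSS IH altprod_odd; field.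
by rewrite !nat1r -?natrD !pnatr_eq0.
Qed.

Lemma sinX_primitive_pihalf_even (R : realType) (m : nat) :
  sinX_primitive m.*2 (pi / 2 : R) = (pi / 2) / altprod R m.*2.
Proof.
elim: m => [|m IH]; first by rewrite double0 altprod0 divr1.
rewrite altprod_evenS.
rewrite doubleS sinX_primitive_pihalfSS IH; field.
by rewrite !nat1r -?natrD !pnatr_eq0 /= (gt_eqF (altprod_gt0 _ _)).
Qed.

Lemma natr_double (R : pzSemiRingType) (m : nat) :
  m.*2%:R = 2 * m%:R :> R.
Proof. by rewrite -mul2n natrM. Qed.

(** This is [I (2m+1) <= I (2m)] with the closed forms of both integrals. *)
Lemma wallis_upper (R : realType) (m : nat) :
  altprod R m.*2 ^+ 2 <= pi * (m%:R + 1 / 2).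
Proof.
have := sinX_primitive_pihalf_nincr R m.*2.
rewrite sinX_primitive_pihalf_odd sinX_primitive_pihalf_even altprod_odd.
have P0 := altprod_gt0 R m.*2.
rewrite ler_pdivlMr// mulrAC ler_pdivrMr// -expr2 => /le_trans; apply.
by rewrite -(natr1 m.*2) natr_double; lra.
Qed.

(** This is [I (2m) <= I (2m-1)] with the closed forms of both integrals. *)
Lemma wallis_lower (R : realType) (m : nat) :
  pi * m%:R <= altprod R m.*2 ^+ 2.
Proof.
case: m => [|m]; first by rewrite mulr0 sqr_ge0.
have := sinX_primitive_pihalf_nincr R m.*2.+1.
rewrite sinX_primitive_pihalf_odd -doubleS sinX_primitive_pihalf_even.
have -> : altprod R m.*2.+1 = altprod R m.+1.*2 / m.+1.*2%:R.
  by rewrite altprod_odd altprod_evenS doubleS; field; rewrite !nat1r -?natrD !pnatr_eq0.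
have P0 := altprod_gt0 R m.+1.*2.
rewrite ler_pdivrMr// mulrAC ler_pdivlMr// -expr2 => /(le_trans _); apply.
by rewrite natr_double; lra.
Qed.

(** * Sharp Wallis bounds *)

(** Passage to the limit in the form used twice below: a monotone sequence is
    compared with its limit through an error of order [1/k]. *)
Lemma ge_of_le_harmonic (R : realType) (x y c : R) (m : nat) :
  (forall k, (m <= k)%N -> x <= y + c / k.+1%:R) -> x <= y.
Proof.
move=> H.
have cv : (y + c * harmonic k) @[k --> \oo] --> y.
  rewrite -[X in _ --> X]addr0 -(mulr0 c).
  apply: cvgD; first exact: cvg_cst.
  by apply: cvgM; [exact: cvg_cst | exact: cvg_harmonic].
rewrite -(cvg_lim _ cv)//.
apply: limr_ge; first by apply/cvg_ex; exists y.
by exists m => // k /= mk; exact: H.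
Qed.

(** The sequence [(W j)^2 / (j + 1/4)] is nonincreasing: the ratio of consecutive
    terms is [(16 j^3 + 36 j^2 + 24 j + 4) / (16 j^3 + 36 j^2 + 24 j + 5)].
    By [wallis_lower] its limit is at least [pi]. *)
Lemma wallis_sharp_lower (R : realType) (m : nat) :
  pi * (m%:R + 1 / 4) <= altprod R m.*2 ^+ 2.
Proof.
have d0 (k : nat) : 0 < k%:R + 1 / 4 :> R by rewrite ltr_wpDl// divr_gt0.
pose a (k : nat) : R := altprod R k.*2 ^+ 2 / (k%:R + 1 / 4).
have a_nincr : nonincreasing_seq a.
  apply/nonincreasing_seqP => j; rewrite /a.
  rewrite altprod_evenS -(natr1 j.*2.+1) -(natr1 j.*2) -(natr1 j) natr_double.
  rewrite exprMn -mulrA ler_wpM2l ?sqr_ge0//.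
  have J : 0 <= j%:R :> R by [].
  rewrite ler_pdivrMr; last by lra.
  rewrite -[leRHS]mulrC ler_pdivlMr; last by lra.
  rewrite expr_div_n mulrAC ler_pdivrMr; last by nra.
  nra.
rewrite -ler_pdivlMr//.
apply: (@ge_of_le_harmonic _ _ _ pi m) => k mk.
apply: (@le_trans _ _ (a k + pi / k.+1%:R)); last by rewrite lerD2r a_nincr.
have W := wallis_lower R k.
have P := pi_gt0 R.
have K : 0 <= k%:R :> R by [].
rewrite -(natr1 k).
apply: (@le_trans _ _ (pi * k%:R / (k%:R + 1 / 4) + pi / (k%:R + 1))).
  rewrite -subr_ge0.
  rewrite (_ : _ - pi =
    (pi : R) * (3 / 4 * k%:R / ((k%:R + 1 / 4) * (k%:R + 1)))); last by field; lra.
  rewrite mulr_ge0 ?(ltW P)// divr_ge0 ?mulr_ge0//; lra.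
by rewrite lerD2r ler_pM2r ?invr_gt0.
Qed.

(** The shift [1/4 + 1/(32 m)] starts the asymptotic expansion of
    [(W m)^2 / pi - m]; with it the sequence becomes nondecreasing, its
    limit being at most [pi] by [wallis_upper]. *)
Lemma wallis_sharp_upper (R : realType) (m : nat) : (0 < m)%N ->
  altprod R m.*2 ^+ 2 <= pi * (m%:R + 1 / 4 + (32 * m%:R)^-1).
Proof.
case: m => // m _.
pose e (k : nat) : R := k%:R + 1 / 4 + (32 * k%:R)^-1.
have eS (k : nat) : e k.+1 = (32 * k.+1%:R ^+ 2 + 8 * k.+1%:R + 1) / (32 * k.+1%:R).
  by rewrite /e; field; rewrite !nat1r !pnatr_eq0.
have e0 (k : nat) : 0 < e k.+1 by rewrite ltr_wpDl ?invr_gt0 ?mulr_gt0// addr_ge0// divr_ge0.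
(* The sequence starts at index 1: at 0 the inverse takes its default
   value, and the step from 0 to 1 would decrease. *)
pose b (k : nat) : R := altprod R k.+1.*2 ^+ 2 / e k.+1.
have b_ndecr : nondecreasing_seq b.
  apply/nondecreasing_seqP => i; rewrite /b !eS (altprod_evenS _ i.+1).
  set j := i.+1; have J : 1 <= j%:R :> R by rewrite ler1n.
  rewrite -(natr1 j.*2.+1) -(natr1 j.*2) -(natr1 j) natr_double.
  rewrite exprMn -[leRHS]mulrA ler_wpM2l ?sqr_ge0//.
  rewrite !invf_div [leRHS]mulrA ler_pdivlMr; last by nra.
  rewrite expr_div_n mulrAC ler_pdivrMr; last by nra.
  rewrite -[leRHS]mulrA [leRHS]mulrAC ler_pdivlMr; last by nra.
  (* In the difference of the two quintic polynomials everything of degree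
     at least 2 cancels. *)
  rewrite -subr_ge0 (_ : _ - _ = 32 * (3 * j%:R + 4)); last by ring.
  lra.
rewrite -ler_pdivrMr; last exact: e0.
apply: (@ge_of_le_harmonic _ _ _ pi m) => k mk.
apply: (@le_trans _ _ (b k)); first exact: b_ndecr.
rewrite /b ler_pdivrMr//; apply: le_trans (wallis_upper _ _) _.
set x : R := k.+1%:R.
have X : 1 <= x by rewrite ler1n.
have x0 : 0 <= x^-1 by rewrite invr_ge0; lra.
have y0 : 0 <= (32 * x)^-1 by rewrite invr_ge0; lra.
rewrite [leRHS](_ : _ = (pi : R) * ((1 + x^-1) * e k.+1)); last by ring.
rewrite ler_pM2l ?pi_gt0// /e -/x mulrDl mul1r.
rewrite [X in _ <= _ + X](_ : _ = 1 + x^-1 * (1 / 4 + (32 * x)^-1)); last first.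
  by field; rewrite gt_eqF//; lra.
have : 0 <= x^-1 * (1 / 4 + (32 * x)^-1) by rewrite mulr_ge0 ?addr_ge0 ?divr_ge0.
by move: y0 (_ * (1 / 4 + _)); move: (32 * x)^-1 => y y0 w w0; lra.
Qed.

(** * Logarithmic estimates *)

(** The upper bound is [ln (1 + x) <= x]; the same inequality applied to
    [1/(1 + x) = 1 - x/(1 + x)] gives [x/(1 + x) <= ln (1 + x)]. *)
Lemma ler_dist_ln1D (R : realType) (x : R) :
  `|x| <= 1 / 2 -> `|ln (1 + x) - x| <= 2 * x ^+ 2.
Proof.
rewrite ler_norml => /andP[xl xu].
have x1 : 0 < 1 + x by lra.
have up : ln (1 + x) <= x by apply: le_ln1Dx; lra.
have lo : x / (1 + x) <= ln (1 + x).
  have E : (1 + x)^-1 = 1 + - (x / (1 + x)) by field; lra.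
  have : ln (1 + x)^-1 <= - (x / (1 + x)).
    by rewrite {1}E le_ln1Dx// -subr_gt0 opprK addrC -E invr_gt0.
  by rewrite lnV ?posrE// lerN2.
rewrite ler_norml; apply/andP; split; last by nra.
suff : x - 2 * x ^+ 2 <= x / (1 + x) by lra.
by rewrite ler_pdivlMr//; nra.
Qed.

(** The logarithm of the sharp bounds, where
    [pi (m + 1/4) = pi/2 * (2m + 1/2)].  The width of the interval comes from
    [ln (1 + t) <= t], where [1 + t] is the ratio of the upper bound to the
    lower one. *)
Lemma ln_altprod_even (R : realType) (m : nat) : (0 < m)%N ->
  0 <= 2 * ln (altprod R m.*2) - ln (pi / 2) - ln (m.*2%:R + 1 / 2)
    <= (32 * m%:R ^+ 2)^-1.
Proof.
move=> m0.
have M : 1 <= m%:R :> R by rewrite ler1n.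
have p0 := pi_gt0 R.
have P0 := altprod_gt0 R m.*2.
have lnP : 2 * ln (altprod R m.*2) = ln (altprod R m.*2 ^+ 2).
  by rewrite lnXn// mulr_natl.
have Q0 : 0 < m%:R + 1 / 4 :> R by lra.
have lnQ : ln (pi / 2) + ln (m.*2%:R + 1 / 2) = ln ((pi : R) * (m%:R + 1 / 4)).
  rewrite natr_double -lnM ?posrE; [|lra|lra].
  by congr ln; field.
rewrite -addrA -opprD lnQ lnP; apply/andP; split.
  by rewrite subr_ge0 ler_ln ?posrE ?exprn_gt0 ?mulr_gt0// wallis_sharp_lower.
have := wallis_sharp_upper R _ m0.
set t : R := (32 * m%:R)^-1 / (m%:R + 1 / 4).
have t0 : 0 < t by rewrite divr_gt0// invr_gt0; lra.
have -> : (pi : R) * (m%:R + 1 / 4 + (32 * m%:R)^-1) =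
    pi * (m%:R + 1 / 4) * (1 + t).
  by rewrite /t; field; rewrite !gt_eqF//; lra.
move=> H.
have L : ln (altprod R m.*2 ^+ 2) <= ln ((pi : R) * (m%:R + 1 / 4)) + ln (1 + t).
  have A0 : 0 < pi * (m%:R + 1 / 4) :> R by rewrite mulr_gt0.
  have B0 : 0 < 1 + t by lra.
  by rewrite -lnM ?posrE// ler_ln ?posrE ?exprn_gt0// mulr_gt0.
have T : ln (1 + t) <= t by apply: le_ln1Dx; lra.
have tm : t <= (32 * m%:R ^+ 2)^-1.
  by rewrite /t -invfM lef_pV2 ?posrE//; nra.
lra.
Qed.

(** Both parities at once: [N + 1/2 = N (1 + 1/(2N))] for even [N], and
    [N - 1/2 = N (1 - 1/(2N))] for odd [N = 2m + 1], where [N - 1/2] is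
    [2m + 1/2]. *)
Lemma ln_altprod_near (R : realType) (N : nat) : (1 < N)%N ->
  `|2 * ln (altprod R N) - ln (pi / 2) - (-1) ^+ N * ln N%:R
    - ln (1 + (-1) ^+ N / (2 * N%:R))| <= (2 * N%:R ^+ 2)^-1.
Proof.
move=> N1.
rewrite -signr_odd.
have m0 : (0 < N./2)%N by rewrite half_gt0.
have := odd_double_half N; move: (N./2) m0 (odd N) => m m0 b.
have M : 1 <= m%:R :> R by rewrite ler1n.
have /andP[lo hi] := ln_altprod_even R _ m0.
case: b => /= <-.
  rewrite add1n expr1 mulN1r altprod_odd -(natr1 m.*2).
  set p := altprod R m.*2 in lo hi *.
  have p0 : 0 < p by exact: altprod_gt0.
  have n0 : 0 < m.*2%:R + 1 :> R by rewrite natr_double; lra.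
  rewrite ln_div ?posrE//.
  have E : ln (m.*2%:R + 1 / 2 : R) =
           ln (m.*2%:R + 1) + ln (1 + (-1) / (2 * (m.*2%:R + 1))).
    rewrite -lnM ?posrE//; last first.
      rewrite natr_double mulN1r subr_gt0 invf_lt1; lra.
    by congr ln; field; rewrite gt_eqF.
  have B : (32 * m%:R ^+ 2)^-1 <= (2 * (m.*2%:R + 1) ^+ 2)^-1 :> R.
    by rewrite natr_double lef_pV2 ?posrE; nra.
  rewrite E in lo hi.
  rewrite ler_norml; apply/andP; split; lra.
rewrite add0n expr0 mul1r.
have n0 : 0 < m.*2%:R :> R by rewrite natr_double; lra.
have E : ln (m.*2%:R + 1 / 2 : R) = ln m.*2%:R + ln (1 + 1 / (2 * m.*2%:R)).
  rewrite -lnM ?posrE//.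
  by congr ln; field; rewrite gt_eqF.
have B : (32 * m%:R ^+ 2)^-1 <= (2 * m.*2%:R ^+ 2)^-1 :> R.
  by rewrite natr_double lef_pV2 ?posrE; nra.
rewrite E in lo hi.
rewrite ler_norml; apply/andP; split; lra.
Qed.

Theorem theorem3p7 (R : realType) :
  (fun N : nat => ln (\prod_(1 <= n < N.+1) (n%:R : R) ^ ((-1 : int) ^+ n)))
  = (fun N : nat => ln (Num.sqrt (pi / 2)) + (-1) ^+ N / 2 * ln N%:R
                    + (-1) ^+ N / (4 * N%:R))
  +O_\oo (fun N : nat => (N%:R : R) ^- 2).
Proof.
apply/eqaddOP/bigO_exP.
exists 1 => //.
exists 2%N => // N /= N2.
(* The constant 1 is generous: the two errors, [1/(2N^2)] each, bound twice
   the remainder. *)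
change (`|ln (altprod R N) - (ln (Num.sqrt (pi / 2)) + (-1) ^+ N / 2 * ln N%:R
  + (-1) ^+ N / (4 * N%:R))| <= 1 * `|N%:R ^- 2 : R|).
have n2 : 2 <= N%:R :> R by rewrite ler_nat.
have sqrt_pihalf : 2 * ln (Num.sqrt (pi / 2 : R)) = ln (pi / 2).
  have p0 : 0 < pi / 2 :> R by rewrite divr_gt0// pi_gt0.
  by rewrite -[in RHS](sqr_sqrtr (ltW p0)) lnXn ?sqrtr_gt0// mulr_natl.
set s : R := (-1) ^+ N.
have s2 : s ^+ 2 = 1 by rewrite /s sqrr_sign.
have near := ln_altprod_near R _ N2; rewrite -/s in near.
set x := s / (2 * N%:R) in near.
have xle : `|x| <= 1 / 2.
  rewrite normrM normr_sign mul1r ger0_norm ?invr_ge0 ?mulr_ge0//.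
  by rewrite div1r lef_pV2 ?posrE; lra.
have := ler_dist_ln1D R _ xle.
have x2 : 2 * x ^+ 2 = (2 * N%:R ^+ 2)^-1.
  rewrite /x expr_div_n s2; field; rewrite gt_eqF//; lra.
rewrite x2 => lnx.
have -> : s / (4 * N%:R) = x / 2 by rewrite /x; field; rewrite gt_eqF//; lra.
have q0 : 0 <= N%:R ^- 2 :> R by rewrite invr_ge0 sqr_ge0.
rewrite mul1r (ger0_norm q0).
have qE : (2 * N%:R ^+ 2)^-1 = N%:R ^- 2 / 2 :> R by rewrite invfM mulrC.
move: near lnx; rewrite qE !ler_norml => /andP[l1 u1] /andP[l2 u2].
apply/andP; split; lra.
Qed.
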